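(* Let $\Lambda$ be a lattice in $\mathbb{C}^2$ and let $d\in\mathbb{Z}\setminus\{n^2:n\in\mathbb{Z}\}$ with $d>0$. If the complex torus $\mathbb{C}^2/\Lambda$ admits multiplication by $\sqrt{d}$, then $\mathbb{C}^2/\Lambda$ is algebraic, i.e. an abelian surface.
   Context: A lattice in $\mathbb{C}^2$ is a discrete subgroup of rank $4$. For $d\in\mathbb{Z}\setminus\{n^2:n\in\mathbb{Z}\}$, the torus $A=\mathbb{C}^2/\Lambda$ is said to admit multiplication by $\sqrt{d}$ if there is an injective ring homomorphism $\mathbb{Z}[\sqrt{d}]\hookrightarrow \mathrm{End}(A)=\mathrm{End}(\Lambda)$, i.e. if there is a matrix $D\in \mathrm{M}_2(\mathbb{C})$ with $D^2=d$ (that is, $d$ times the identity matrix) and $D\Lambda\subseteq\Lambda$. Here $\mathrm{End}(\Lambda)=\{M\in\mathrm{M}_2(\mathbb{C}): M\Lambda\subseteq\Lambda\}$. The torus $\mathbb{C}^2/\Lambda$ is algebraic (an abelian surface) if and only if there exists a positive definite hermitian form $H$ on $\mathbb{C}^2$ with $\mathrm{Im}\,H(\Lambda,\Lambda)\subseteq\mathbb{Z}$. *)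

(* Defs.v *)
(* The complex numbers are R[i] for R : realType, and C^2 is the type of column
   vectors over R[i]. *)
From HB Require Import structures.
From mathcomp Require Import all_boot all_order all_algebra.
From mathcomp Require Import complex.
From mathcomp Require Import boolp classical_sets reals topology normedtype.

Set Implicit Arguments.
Unset Strict Implicit.
Unset Printing Implicit Defensive.

Import Order.TTheory GRing.Theory Num.Theory numFieldNormedType.Exports.

Local Open Scope ring_scope.
Local Open Scope classical_set_scope.
Local Open Scope complex_scope.

(* The topology of the absolute value on R[i], which the library only attaches
   to the alias R[i]^o; it induces the product topology on 'cV[R[i]]_2. *)
#[non_forgetful_inheritance]
HB.instance Definition _ (R : realType) := PseudoPointedMetric.copy R[i] R[i]^o.

Section ComplexTori.
Variable R : realType.
Implicit Types L : set 'cV[R[i]]_2.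

Definition is_subgroup L : Prop :=
  L 0 /\ (forall x y, L x -> L y -> L (x - y)).

Definition is_discrete L : Prop := L `<=` isolated L.

Definition Z_combination n (b : 'I_n -> 'cV[R[i]]_2) (c : 'I_n -> int) :
    'cV[R[i]]_2 :=
  \sum_(i < n) b i *~ c i.

Definition is_Z_basis n (b : 'I_n -> 'cV[R[i]]_2) L : Prop :=
  (forall c, Z_combination b c = 0 -> forall i, c i = 0) /\
  L = range (Z_combination b).

(* Discrete subgroups of C^2 are free abelian, so the rank of L is the
   cardinality of a Z-basis. *)
Definition has_rank L (n : nat) : Prop :=
  exists b : 'I_n -> 'cV[R[i]]_2, is_Z_basis b L.

Definition is_lattice L : Prop :=
  [/\ is_subgroup L, is_discrete L & has_rank L 4].

Definition End_lattice L : set 'M[R[i]]_2 :=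
  [set M | forall x, L x -> L (M *m x)].

Definition admits_sqrt_multiplication L (d : int) : Prop :=
  exists2 D : 'M[R[i]]_2, End_lattice L D & D *m D = (d%:~R)%:M.

(* Riemann's condition for C^2 / L to be an abelian surface. The forms of type
   {dot _ for conjc} are the positive definite hermitian forms, linear in the
   first argument and conjugate-linear in the second one. *)
Definition is_algebraic_torus L : Prop :=
  exists H : {dot 'cV[R[i]]_2 for conjc},
    forall x y, L x -> L y -> complex.Im (H x y) \is a Num.int.

End ComplexTori.

(* Main.v *)
Require Import Defs.
From HB Require Import structures.
From mathcomp Require Import all_boot all_order all_algebra.
From mathcomp Require Import complex.
From mathcomp Require Import boolp classical_sets reals topology normedtype.
From mathcomp Require Import ring lra zify.
Import Order.TTheory GRing.Theory Num.Theory numFieldNormedType.Exports.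
Import ComplexField.Normc.

Local Open Scope ring_scope.
Local Open Scope classical_set_scope.
Local Open Scope complex_scope.

(** Let s be the real square root of d, D the matrix giving the multiplication
    and L the lattice.

    The rational span of L is a plane over the field Q(s), with s acting
    through D. Hence there are x, y in L such that x, D x, y, D y generate a
    subgroup of finite index N ([lattice_generators]). These four vectors are
    independent over Z, hence over the real numbers, because L is discrete: by
    the pigeonhole principle, Z-independent vectors with a real relation have
    arbitrarily small nonzero integral combinations
    ([dirichlet_small_combination], [discrete_Z_free_real_free]). In
    particular D is not a scalar: a relation D x = c x with c real is
    excluded. So D has both eigenvalues s and -s, and there are linear forms f
    and g on C^2, jointly injective, with f D = s f and g D = - s g.

    Every form
      H (z, z') = a f(z) f(z')^* + b g(z) g(z')^*   with a, b > 0
    is hermitian and positive definite, and a, b can be chosen such that Im H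
    is integral on L. For z in L there are u, v in Z[s], with conjugates u1
    and v1, such that N z = u x + v y in the sense of the action of Z[s], so
    that
      f(N z) = u f(x) + v f(y)   and   g(N z) = u1 g(x) + v1 g(y).
    Thus Im (f(N z) f(N z')^* ) = e A, where e in Z[s] is an alternating
    bilinear expression in the coordinates, and A = Im (f(y) f(x)^* ) is the
    signed area spanned by f(x) and f(y). Likewise g gives e1 B, with e1 the
    conjugate of e and B the area for g. Both areas are nonzero, again by real
    independence. Now take a = N^2 t / |A| and b = N^2 t / |B|. If A and B
    have the same sign, t = 1 makes Im H, up to sign, the trace e + e1 in Z;
    otherwise t = s makes it the trace of s e, namely s (e - e1), in Z. Here
    d > 0 matters: s is real, so that an element of Q(s) and its conjugate can
    have any prescribed pair of signs. *)

(** * Integral and real independence in a discrete subgroup *)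

(** More unknowns than forms: the integral points of a large cube outnumber the
    unit cells that contain their images, and the difference of two points in
    the same cell is the required combination. *)
Lemma dirichlet_small_combination (R : archiRealFieldType) (m n : nat)
    (A : 'M[R]_(m, n)) : (m < n)%N ->
  exists2 c : 'I_n -> int, (exists i, c i != 0) &
    forall k, `|\sum_i A k i * (c i)%:~R| < 1.
Proof.
move=> lt_mn.
pose K0 := Num.bound (\sum_k \sum_i `|A k i|).
have AK k : \sum_i `|A k i| <= K0%:R.
  apply: (@le_trans _ _ (\sum_k \sum_i `|A k i|)).
    rewrite [leRHS](bigD1 k) //= lerDl; apply: sumr_ge0 => j _.
    by apply: sumr_ge0.
  apply/ltW/archi_boundP; apply: sumr_ge0 => j _.
  by apply: sumr_ge0.
(* With K = K0 B, the values of each form on [0, B]^n lie in [- K, K], which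
   meets 2 K + 1 cells. The choice of B gives
   (2 K + 1)^m <= B (B + 1)^m < (B + 1)^n. *)
pose B := ((2 * K0).+1 ^ m)%N.
pose K := (K0 * B)%N.
pose val (c : {ffun 'I_n -> 'I_B.+1}) k : R := \sum_i A k i * (c i : nat)%:R.
have valK c k : `|val c k| <= K%:R.
  apply: (le_trans (ler_norm_sum _ _ _)).
  rewrite natrM; apply: (@le_trans _ _ (\sum_i `|A k i| * B%:R)).
    apply: ler_sum => i _; rewrite normrM ler_wpM2l // normr_nat ler_nat.
    by rewrite -ltnS.
  by rewrite -mulr_suml ler_wpM2r.
have cell_ltn c k : (Num.truncn (val c k + K%:R) < (2 * K).+1)%N.
  have := valK c k; rewrite ler_norml => /andP[h1 h2].
  rewrite ltnS -(ler_nat R); apply: (@le_trans _ _ (val c k + K%:R)).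
    by rewrite truncn_le // -lerBlDr sub0r.
  by rewrite natrM mulrDl mul1r lerD2r.
pose cell (c : {ffun 'I_n -> 'I_B.+1}) : {ffun 'I_m -> 'I_(2 * K).+1} :=
  [ffun k => Ordinal (cell_ltn c k)].
have [c1 [c2 c12 cell12]] :
    exists c1, exists2 c2, c1 != c2 & cell c1 = cell c2.
  apply/injectivePn/negP => /injectiveP /leq_card.
  rewrite !card_ffun !card_ord leqNgt => /negP; apply.
  apply: (@leq_trans (B.+1 ^ m.+1)); last by rewrite leq_exp2l // ltnS expn_gt0.
  apply: (@leq_ltn_trans (B * B.+1 ^ m)%N); last first.
    by rewrite expnS ltn_pmul2r // expn_gt0.
  rewrite -expnMn; have [->//|m0] := posnP m.
  by rewrite leq_exp2r // /K; nia.
exists (fun i => (c1 i : nat)%:Z - (c2 i : nat)%:Z).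
  have /existsP [k ck] : [exists i, c1 i != c2 i].
    rewrite -negb_forall; apply: contra c12 => /forallP h.
    by apply/eqP/ffunP => i; apply/eqP.
  by exists k; rewrite subr_eq0 eqz_nat.
move=> k.
have -> : \sum_i A k i * ((c1 i : nat)%:Z - (c2 i : nat)%:Z)%:~R =
    val c1 k - val c2 k.
  rewrite /val -sumrB; apply: eq_bigr => i _.
  by rewrite intrB mulrBr.
have ge0 c : 0 <= val c k + K%:R.
  by have := valK c k; rewrite ler_norml => /andP[h1 _]; rewrite -lerBlDr sub0r.
have := congr1 (fun h : {ffun _} => nat_of_ord (h k)) cell12.
rewrite !ffunE /= => e.
have /andP[l1 u1] := truncn_itv (ge0 c1).
have /andP[l2 u2] := truncn_itv (ge0 c2).
rewrite e in l1 u1.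
move: l1 u1 l2 u2; rewrite -natr1 => *.
by rewrite ltr_norml; apply/andP; split; lra.
Qed.

Lemma discrete_zero_ball (R : realType) (L : set 'cV[R[i]]_2) :
  L 0 -> is_discrete L ->
  exists2 e : R, 0 < e & forall y, L y -> (forall i, `|y i 0| < e%:C) -> y = 0.
Proof.
move=> L0 /(_ _ L0) [_ [V V0 VL]].
move/(nbhs_ballP (R := R[i])): V0 => [e e0 eV].
move: (e0); rewrite /= ltcE /= => /andP[/eqP im0 re0].
exists (complex.Re e) => // y Ly ylt.
suff : (V `&` L) y by rewrite VL.
split=> //; apply: eV; split=> // i j.
rewrite ord1 mxE.
change (`|0 - y i 0| < e); rewrite sub0r normrN.
have := ylt i; rewrite [X in _ < X -> _](_ : _ = e) //.
by case: (e) im0 => /= a b ->.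
Qed.

Lemma Z_combinationE (R : realType) n (b : 'I_n -> 'cV[R[i]]_2) c :
  Z_combination b c = \sum_i (c i)%:~R *: b i.
Proof. by apply: eq_bigr => i _; rewrite scaler_int. Qed.

Lemma subgroup_Z_combination (R : realType) (L : set 'cV[R[i]]_2) n
    (b : 'I_n -> 'cV[R[i]]_2) c :
  is_subgroup L -> (forall i, L (b i)) -> L (Z_combination b c).
Proof.
move=> [L0 LB] Lb.
have LN x : L x -> L (- x) by move=> Lx; rewrite -sub0r; apply: LB.
have LD x y : L x -> L y -> L (x + y).
  by move=> Lx Ly; rewrite -[y]opprK; apply: LB => //; apply: LN.
rewrite /Z_combination; apply: big_ind => // k _.
have LM m : L (b k *+ m).
  by elim: m => [|m IH]; rewrite ?mulr0n // mulrS; apply: LD.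
by case: (c k) => m; [apply: LM|apply/LN/LM].
Qed.

(** A real relation between n + 1 vectors expresses one of them, [v j], by the n
    others, so that integral combinations are controlled by n real forms in
    n + 1 unknowns. Making these forms small produces a nonzero vector of [L]
    near 0. *)
Lemma discrete_Z_free_real_free (R : realType) (L : set 'cV[R[i]]_2) n
    (v : 'I_n -> 'cV[R[i]]_2) :
  is_subgroup L -> is_discrete L -> (forall k, L (v k)) ->
  (forall c, Z_combination v c = 0 -> forall k, c k = 0) ->
  forall t : 'I_n -> R, \sum_k (t k)%:C *: v k = 0 -> forall k, t k = 0.
Proof.
move=> Lsub Ldisc Lv vfree t tv0 j; apply/eqP/negPn/negP => tj0.
case: n => [|n] in v t j Lv vfree tv0 tj0 *; first by case: j tj0.
have [e e0 small] := discrete_zero_ball _ _ Lsub.1 Ldisc.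
pose S := \sum_k \sum_(i < 2) normc (v k i 0).
have normc_ge0 (z : R[i]) : 0 <= normc z by case: z => x y; exact: sqrtr_ge0.
have S0 : 0 <= S by apply: sumr_ge0 => k _; exact: sumr_ge0.
pose Bd := (n%:R * S + 1) / e.
have Bd0 : 0 < Bd by rewrite divr_gt0 // ltr_wpDl ?mulr_ge0.
(* Row k of A is Bd times the coefficient of v (lift j k) after the
   elimination of v j. *)
pose A : 'M[R]_(n, n.+1) := \matrix_(k, l)
  (Bd * ((l == lift j k)%:R - (l == j)%:R * (t (lift j k) / t j))).
have [c [l cl] cA] := dirichlet_small_combination R n n.+1 A (ltnSn n).
have AE k : \sum_i A k i * (c i)%:~R =
    Bd * ((c (lift j k))%:~R - (c j)%:~R * (t (lift j k) / t j)).
  have delta l0 x : \sum_l (l == l0)%:R * x * (c l)%:~R = x * (c l0)%:~R :> R.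
    rewrite (bigD1 l0) //= eqxx mul1r big1 ?addr0 // => l' /negPf->.
    by rewrite !mul0r.
  transitivity (\sum_l' ((l' == lift j k)%:R * Bd * (c l')%:~R -
      (l' == j)%:R * (Bd * (t (lift j k) / t j)) * (c l')%:~R)).
    by apply: eq_bigr => l' _; rewrite mxE; move: (t _ / t _) => q; ring.
  by rewrite sumrB !delta; move: (t _ / t _) => q; ring.
move: cl; rewrite (vfree c) ?eqxx //.
apply: small; first exact: subgroup_Z_combination.
move=> i.
have -> : Z_combination v c = \sum_k
    ((c (lift j k))%:~R - (c j)%:~R * (t (lift j k) / t j))%:C *: v (lift j k).
  have vj : v j = - \sum_k (t (lift j k) / t j)%:C *: v (lift j k).
    move: tv0; rewrite (bigD1_ord j) //= => /eqP; rewrite addr_eq0 => /eqP h.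
    have -> : v j = ((t j)^-1)%:C *: ((t j)%:C *: v j).
      by rewrite scalerA -rmorphM mulVf // scale1r.
    rewrite h scalerN scaler_sumr; congr (- _); apply: eq_bigr => k _.
    by rewrite scalerA -rmorphM mulrC.
  rewrite Z_combinationE (bigD1_ord j) //= vj scalerN scaler_sumr.
  rewrite -sumrN -big_split /=.
  apply: eq_bigr => k _.
  rewrite scalerA -scaleNr -scalerDl; congr (_ *: _).
  by rewrite [RHS]rmorphB [in RHS]rmorphM !rmorph_int addrC.
rewrite summxE.
set z := \sum_(k < n) _.
change ((normc z)%:C < e%:C); rewrite ltcR.
have le1 : normc z <= \sum_(k < n) Bd^-1 * S.
  have : normc z <= \sum_(k < n) normc
      ((((c (lift j k))%:~R - (c j)%:~R * (t (lift j k) / t j))%:C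
        *: v (lift j k)) i 0).
    rewrite /z; elim/big_rec2: _ => [|k x y _ le_xy]; first by rewrite normc0.
    by apply: le_trans (le_normcD _ _) _; rewrite lerD2l.
  move=> /le_trans; apply; apply: ler_sum => k _.
  rewrite mxE normcM ler_pM //.
    have := cA k; rewrite AE normrM gtr0_norm // => /ltW.
    rewrite -ler_pdivlMl // mulr1; move: (_ - _) => y.
    by rewrite /= expr0n addr0 sqrtr_sqr.
  rewrite /S (bigD1 (lift j k)) //= (bigD1 i) //= -addrA lerDl addr_ge0 //.
    exact: sumr_ge0.
  by apply: sumr_ge0 => k' _; exact: sumr_ge0.
apply: le_lt_trans le1 _.
rewrite sumr_const card_ord -mulr_natl /Bd invf_div.
have -> : n%:R * (e / (n%:R * S + 1) * S) = e * (n%:R * S) / (n%:R * S + 1).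
  by move: (_^-1) => q; ring.
rewrite ltr_pdivrMr; last by rewrite ltr_wpDl ?mulr_ge0.
by rewrite ltr_pM2l // ltrDl.
Qed.

(** * A lattice with real multiplication is a quadratic module of rank two *)

(** As [a] is not a square, [T] makes the space of rows a vector space over the
    field obtained by adjoining a square root of [a]. The first basis vector
    spans a line, of dimension two over [F], and any basis vector outside this
    line completes it to a basis of a plane. *)
Lemma quadratic_pair_free (F : fieldType) n (T : 'M[F]_n.+3) (a : F) :
  (forall q, q ^+ 2 != a) -> T *m T = a%:M ->
  exists j, let M k := let r := delta_mx 0 k : 'rV_n.+3 in col_mx r (r *m T) in
    row_free (col_mx (M 0) (M j)).
Proof.
move=> nsq TT.
pose M k := let r := delta_mx 0 k : 'rV_n.+3 in col_mx r (r *m T).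
have free2 m (V : 'M[F]_(m, n.+3)) (r : 'rV[F]_n.+3) p q : stablemx V T ->
    ~~ (r <= V)%MS -> ((p *: r + q *: (r *m T))%R <= V)%MS -> p = 0 /\ q = 0.
  move=> VT rV pqV.
  (* Multiply p + q T by its conjugate p - q T. *)
  have : ((p *: (p *: r + q *: (r *m T)) -
      q *: ((p *: r + q *: (r *m T)) *m T))%R <= V)%MS.
    apply: addmx_sub; rewrite ?eqmx_opp; apply: scalemx_sub => //.
    by apply: (submx_trans _ VT); apply: submxMr.
  have -> : p *: (p *: r + q *: (r *m T)) -
      q *: ((p *: r + q *: (r *m T)) *m T) =
      (p ^+ 2 - a * q ^+ 2) *: r.
    rewrite mulmxDl -!scalemxAl -mulmxA TT mul_mx_scalar.
    apply/matrixP => x y; rewrite !mxE; ring.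
  have [/eqP|nz] := eqVneq (p ^+ 2 - a * q ^+ 2) 0; last first.
    by rewrite eqmx_scale // (negPf rV).
  rewrite subr_eq0 => /eqP pq _.
  have [q0|q0] := eqVneq q 0.
    by move: pq; rewrite q0 expr0n mulr0 => /eqP; rewrite sqrf_eq0 => /eqP.
  case/eqP: (nsq (p / q)); rewrite expr_div_n pq mulfK // expf_neq0 //.
pose W := M 0.
have [j jW] : exists j, ~~ ((delta_mx 0 j : 'rV_n.+3) <= W)%MS.
  apply/existsP; rewrite -negb_forall; apply/negP => /forallP h.
  have : (1%:M <= W)%MS.
    by apply/row_subP => k; rewrite row1.
  move/mxrankS; rewrite mxrank1 => /leq_trans /(_ (rank_leq_row _)).
  by [].
exists j => /=; rewrite -kermx_eq0; apply/eqP/row_matrixP => k; rewrite row0.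
have : row k (kermx (col_mx (M 0) (M j))) *m (col_mx (M 0) (M j)) = 0.
  by rewrite -row_mul mulmx_ker row0.
move: (row k _) => c.
have pairE (w : 'rV[F]_(1 + 1)) l :
    w *m M l = w 0 (lshift 1 0) *: delta_mx 0 l +
      w 0 (rshift 1 0) *: (delta_mx 0 l *m T).
  rewrite -{1}[w]hsubmxK mul_row_col.
  rewrite [lsubmx w]mx11_scalar [rsubmx w]mx11_scalar.
  by rewrite !mul_scalar_mx !mxE.
have pair0 (w : 'rV[F]_(1 + 1)) :
    w 0 (lshift 1 0) = 0 /\ w 0 (rshift 1 0) = 0 -> w = 0.
  move=> [w0 w1]; rewrite -[w]hsubmxK.
  rewrite [lsubmx w]mx11_scalar [rsubmx w]mx11_scalar.
  by rewrite !mxE w0 w1 !raddf0 row_mx0.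
rewrite -[c]hsubmxK mul_row_col; set c1 := lsubmx c; set c2 := rsubmx c => c12.
have WT : stablemx W T.
  rewrite /W /M mul_col_mx -mulmxA TT mul_mx_scalar.
  rewrite col_mx_sub scalemx_sub ?andbT.
    by apply: submx_trans (addsmxSr _ _) _; rewrite addsmxE.
  by apply: submx_trans (addsmxSl _ _) _; rewrite addsmxE.
have c20 : c2 = 0.
  apply/pair0/(free2 _ W (delta_mx 0 j)) => //; rewrite -pairE.
  move/eqP: c12; rewrite addrC addr_eq0 => /eqP ->.
  by rewrite eqmx_opp submxMl.
have c10 : c1 = 0.
  apply/pair0/(free2 _ (0 : 'M_n.+3) (delta_mx 0 0)).
  - by rewrite mul0mx.
  - rewrite submx0; apply/eqP => /matrixP /(_ 0 0) /eqP.
    by rewrite !mxE !eqxx oner_eq0.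
  - by rewrite -pairE; move: c12; rewrite c20 mul0mx addr0 => ->; exact: sub0mx.
by rewrite c10 c20 row_mx0.
Qed.

Lemma nonsquare_rat (d : int) : (forall n : int, d <> n ^+ 2) ->
  forall q : rat, q ^+ 2 != d%:~R.
Proof.
move=> nsq q; apply/eqP => qd.
have nd : numq q ^+ 2 = d * denq q ^+ 2.
  have := congr1 ( *%R^~ ((denq q)%:~R ^+ 2)) qd.
  rewrite /= -exprMn -{1}[q]divq_num_den divfK ?intr_eq0 ?denq_neq0 //.
  by rewrite -!rmorphXn -rmorphM => /intr_inj.
have den1 : denq q = 1.
  have : coprimez (denq q) (numq q ^+ 2).
    by rewrite coprimezXr // coprimez_sym coprimezE coprime_num_den.
  rewrite nd expr2 mulrA /coprimez gcdzMl => /eqP.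
  by rewrite absz_denq.
by apply: (nsq (numq q)); rewrite nd den1 expr1n mulr1.
Qed.

(** In coordinates on a Z-basis of [L], [D] is an integral matrix [T] of square
    [d], to which [quadratic_pair_free] applies over the rational numbers. The
    index [N] is the determinant of the coordinates of the four vectors:
    multiplying by the adjugate matrix expresses [N z] by them with integral
    coefficients. *)
Lemma lattice_generators (R : realType) (L : set 'cV[R[i]]_2) (d : int)
    (D : 'M[R[i]]_2) :
  is_lattice L -> (forall n : int, d <> n ^+ 2) ->
  End_lattice L D -> D *m D = (d%:~R)%:M ->
  exists x y : 'cV[R[i]]_2,
    (forall p q r t : R, p%:C *: x + q%:C *: (D *m x) +
        (r%:C *: y + t%:C *: (D *m y)) = 0 ->
      [/\ p = 0, q = 0, r = 0 & t = 0]) /\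
    exists2 N : int, N != 0 & forall z, L z -> exists p q r t : int,
      N%:~R *: z = p%:~R *: x + q%:~R *: (D *m x) +
        (r%:~R *: y + t%:~R *: (D *m y)).
Proof.
move=> [Lsub Ldisc [b [bfree Lb]]] nsq LD DD.
pose comb (r : 'rV[int]_4) := Z_combination b (r 0).
have Lcomb r : L (comb r) by rewrite Lb; exists (r 0).
have combP z : L z -> exists r, z = comb r.
  rewrite Lb => -[c _ <-]; exists (\row_k c k).
  by apply: eq_bigr => k _; rewrite mxE.
have comb0 r : comb r = 0 -> r = 0.
  by move=> /bfree r0; apply/rowP => k; rewrite mxE.
have comb_inj : injective comb.
  move=> r s rs; apply/eqP; rewrite -subr_eq0; apply/eqP/comb0.
  rewrite -[RHS](subrr (comb r)) {2}rs /comb !Z_combinationE -sumrB.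
  by apply: eq_bigr => k _; rewrite !mxE intrB scalerBl.
have combZ k r : comb (k *: r) = k%:~R *: comb r.
  rewrite /comb !Z_combinationE scaler_sumr; apply: eq_bigr => l _.
  by rewrite mxE intrM scalerA.
have combM m (A : 'M[int]_(m, 4)) r :
    comb (r *m A) = \sum_k (r 0 k)%:~R *: comb (row k A).
  under eq_bigr do rewrite -combZ /comb /Z_combination.
  rewrite exchange_big; apply: eq_bigr => l _ /=.
  by rewrite mxE -mulrz_sumr; congr (_ *~ _); apply: eq_bigr => k _; rewrite !mxE.
have comb_delta k : comb (delta_mx 0 k) = b k.
  rewrite /comb Z_combinationE (bigD1 k) //= big1 ?addr0 ?mxE ?eqxx ?scale1r //.
  by move=> l lk; rewrite mxE eqxx (negPf lk) scale0r.
have [T bT] : exists T : 'M[int]_4, forall k, D *m b k = comb (row k T).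
  have /choice[T bT] : forall k, exists r, D *m b k = comb r.
    by move=> k; apply/combP/LD; rewrite -comb_delta.
  by exists (\matrix_k T k) => k; rewrite rowK.
have DT r : D *m comb r = comb (r *m T).
  rewrite combM /comb Z_combinationE mulmx_sumr; apply: eq_bigr => k _.
  by rewrite -scalemxAr bT.
have TT : T *m T = d%:M.
  apply/row_matrixP => k; rewrite !rowE; apply: comb_inj.
  rewrite mulmxA -!DT mulmxA DD mul_scalar_mx.
  by rewrite mul_mx_scalar combZ.
pose TQ := map_mx intr T : 'M[rat]_4.
have TTQ : TQ *m TQ = (d%:~R)%:M.
  by rewrite -map_mxM TT map_scalar_mx.
have [j] := quadratic_pair_free _ _ TQ _ (nonsquare_rat d nsq) TTQ.
pose M k := let r := delta_mx 0 k : 'rV[int]_4 in col_mx r (r *m T).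
pose B : 'M[int]_(1 + 1 + (1 + 1)) := col_mx (M 0) (M j).
rewrite /= -!(map_delta_mx (intr : int -> rat)) -!map_mxM -!map_col_mx => Bfree.
have detB : \det B != 0.
  by move: Bfree; rewrite -/B row_free_unit unitmxE det_map_mx unitfE intr_eq0.
pose v k := comb (row k B).
have sum_v (t : 'I_(1 + 1 + (1 + 1)) -> R[i]) : \sum_k t k *: v k =
    t (lshift 2 (lshift 1 0)) *: b 0 +
      t (lshift 2 (rshift 1 0)) *: (D *m b 0) +
    (t (rshift 2 (lshift 1 0)) *: b j +
      t (rshift 2 (rshift 1 0)) *: (D *m b j)).
  rewrite !big_split_ord /= !big_ord1 /v /B !(rowKu, rowKd).
  by rewrite -!comb_delta !DT !row_id.
exists (b 0), (b j); split.
  move=> p q r t h.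
  pose w : 'rV[R]_(1 + 1 + (1 + 1)) :=
    row_mx (row_mx p%:M q%:M) (row_mx r%:M t%:M).
  have w0 : forall k, w 0 k = 0.
    apply: (discrete_Z_free_real_free _ _ _ v Lsub Ldisc) => [k|c|].
    - exact: Lcomb.
    - rewrite Z_combinationE => vc k.
      have : (\row_k c k) *m B = 0.
        apply: comb0; rewrite combM -[RHS]vc.
        by apply: eq_bigr => l _; rewrite mxE.
      move/(congr1 (mulmx^~ (\adj B))).
      rewrite -mulmxA mul_mx_adj mul0mx mul_mx_scalar.
      move=> /rowP /(_ k) /eqP.
      by rewrite !mxE mulf_eq0 (negPf detB) => /eqP.
    - by rewrite sum_v !(row_mxEl, row_mxEr) !mxE !eqxx !mulr1n.
  have := (w0 (lshift 2 (lshift 1 0)), w0 (lshift 2 (rshift 1 0)),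
    w0 (rshift 2 (lshift 1 0)), w0 (rshift 2 (rshift 1 0))).
  by rewrite /w !(row_mxEl, row_mxEr) !mxE !eqxx !mulr1n => -[[[]]].
exists (\det B) => // z /combP[r ->].
rewrite -combZ -mul_mx_scalar -mul_adj_mx mulmxA combM sum_v.
by do 4!eexists.
Qed.

(** * Eigenforms of the multiplication *)

(** The rows of [D + s] are left eigenvectors, because
    [(D + s) (D - s) = 0]. *)
Lemma left_eigenvector (F : fieldType) n (D : 'M[F]_n) (s : F) :
  D *m D = (s ^+ 2)%:M -> D + s%:M != 0 ->
  exists2 f : 'rV_n, f != 0 & f *m D = s *: f.
Proof.
move=> DD Ds0.
have [k rk] : exists k, row k (D + s%:M) != 0.
  apply/existsP; rewrite -negb_forall; apply: contra Ds0 => /forallP h.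
  by apply/eqP/row_matrixP => k; rewrite row0; apply/eqP.
exists (row k (D + s%:M)) => //.
rewrite -row_mul mulmxDl DD mul_scalar_mx -linearZ /= scalerDr addrC.
by rewrite scale_scalar_mx -expr2.
Qed.

(** Eigenvectors for the distinct eigenvalues [s] and [- s] are independent, so
    that [f] and [g] are coordinates on the plane. *)
Lemma eigenvectors_separate (F : fieldType) (D : 'M[F]_2) (s : F)
    (f g : 'rV_2) :
  s *+ 2 != 0 -> f != 0 -> g != 0 -> f *m D = s *: f -> g *m D = - s *: g ->
  forall z : 'cV_2, f *m z = 0 -> g *m z = 0 -> z = 0.
Proof.
move=> s2 f0 g0 fD gD z fz gz.
have free : row_free (col_mx f g : 'M_(1 + 1, 2)).
  rewrite -kermx_eq0; apply/eqP/row_matrixP => k; rewrite row0.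
  have : row k (kermx (col_mx f g)) *m col_mx f g = 0.
    by rewrite -row_mul mulmx_ker row0.
  move: (row k _) => c; rewrite -[c]hsubmxK mul_row_col.
  rewrite [lsubmx c]mx11_scalar [rsubmx c]mx11_scalar !mul_scalar_mx.
  move: (lsubmx c 0 0) (rsubmx c 0 0) => p q pq.
  (* Compare the image of the relation under D with s times the relation. *)
  have q0 : q *: g = 0.
    have := congr1 (mulmx^~ D) pq.
    rewrite /= mul0mx mulmxDl -!scalemxAl fD gD !scalerA mulrN scaleNr => pqD.
    have : (s *+ 2) *: (q *: g) = 0.
      rewrite -[RHS](scaler0 _ s) -pq -[X in _ = X]subr0 -[X in _ - X]pqD.
      by apply/rowP => k'; rewrite !mxE; ring.
    by move/eqP; rewrite scaler_eq0 (negPf s2) => /eqP.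
  move: pq; rewrite q0 addr0 => /eqP.
  rewrite scaler_eq0 (negPf f0) orbF => /eqP->.
  move/eqP: q0; rewrite scaler_eq0 (negPf g0) orbF => /eqP->.
  by rewrite !raddf0 row_mx0.
have unit_fg : (col_mx f g : 'M_(1 + 1)) \in unitmx by rewrite -row_free_unit.
apply: (can_inj (mulKmx unit_fg)).
by rewrite mulmx0 mul_col_mx fz gz col_mx0.
Qed.

(** * Hermitian forms and areas *)

Lemma hermitian_pair (R : realType) (f g : 'rV[R[i]]_2) (a b : R) :
  0 < a -> 0 < b ->
  (forall z : 'cV[R[i]]_2, f *m z = 0 -> g *m z = 0 -> z = 0) ->
  exists H : {dot 'cV[R[i]]_2 for conjc}, forall x y,
   H x y = a%:C * ((f *m x) 0 0 * ((f *m y) 0 0)^*) +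
           b%:C * ((g *m x) 0 0 * ((g *m y) 0 0)^*).
Proof.
move=> a0 b0 inj.
pose h (x y : 'cV[R[i]]_2) := a%:C * ((f *m x) 0 0 * ((f *m y) 0 0)^*) +
           b%:C * ((g *m x) 0 0 * ((g *m y) 0 0)^*).
have h1 y : zmod_morphism (h ^~ y).
  by move=> u v; rewrite /h !mulmxBr !mxE; ring.
have h2 x : zmod_morphism (h x).
  by move=> u v; rewrite /h !mulmxBr !mxE !rmorphB /=; ring.
have h3 y : scalable_for *%R (h ^~ y).
  by move=> c u; rewrite /h -!scalemxAr !mxE /=; ring.
have h4 x : scalable_for (conjc \; *%R) (h x).
  by move=> c u; rewrite /h -!scalemxAr !mxE /= !rmorphM /=; ring.
have h5 x y : h x y = (-1) ^+ false * conjc (h y x).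
  have conj_term c (w1 w2 : R[i]) : (c%:C * (w1 * w2^*))^* = c%:C * (w2 * w1^*).
    by case: w1 w2 => a1 b1 [a2 b2]; apply/eqP; rewrite eq_complex /=;
       apply/andP; split; apply/eqP; ring.
  by rewrite expr0 mul1r /h rmorphD /= !conj_term.
have h6 u : u != 0 -> 0 < h u u.
  move=> u0.
  have ge0 c (w : R[i]) : 0 < c -> 0 <= c%:C * (w * w^*).
    by move=> c0; rewrite mulr_ge0 ?mulcJ_ge0 // ler0c ltW.
  rewrite lt_def addr_ge0 ?ge0 // andbT paddr_eq0 ?ge0 //.
  apply: contra u0 => /andP[].
  rewrite !mulf_eq0 !conjc_eq0 !orbb.
  have nz c : 0 < c -> c%:C == 0 :> R[i] = false.
    by move=> c0; rewrite eq_complex /= eqxx andbT gt_eqF.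
  rewrite !nz //= => /eqP fu /eqP gu.
  have mx11_0 (w : 'M[R[i]]_1) : w 0 0 = 0 -> w = 0.
    by move=> w0; apply/matrixP => j k; rewrite !ord1 w0 mxE.
  by apply/eqP/inj; apply: mx11_0.
pose m1 := isBilinear.Build _ _ _ _ _ _ h h1 h2 h3 h4.
pose m2 := isHermitianSesquilinear.Build _ _ _ _ h h5.
pose m3 := isDotProduct.Build _ _ h h6.
pose H : {dot 'cV[R[i]]_2 for conjc} := HB.pack h m1 m2 m3.
by exists H.
Qed.

Lemma Im_mulJ_real_dependent (R : realType) (u v : R[i]) :
  complex.Im (v * u^*) = 0 ->
  exists p r : R, (p != 0) || (r != 0) /\ p%:C * u + r%:C * v = 0.
Proof.
case: u v => [u1 u2] [v1 v2] /= Im0.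
have [[-> ->]|u0] := pselect (u1 = 0 /\ u2 = 0).
  exists 1, 0; rewrite oner_eq0; split=> //.
  by apply/eqP; rewrite eq_complex /=; apply/andP; split; apply/eqP; ring.
(* The coefficients are - Re (v u^* ) and |u|^2, where v u^* is real. *)
exists (- (v1 * u1 + v2 * u2)), (u1 ^+ 2 + u2 ^+ 2); split.
  apply/orP; right; rewrite paddr_eq0 ?sqr_ge0 // !sqrf_eq0.
  by apply/negP => /andP[/eqP e1 /eqP e2]; apply: u0.
apply/eqP; rewrite eq_complex /=; apply/andP; split; apply/eqP.
  by transitivity (- u2 * (v1 * - u2 + v2 * u1)); [ring | rewrite Im0 mulr0].
by transitivity (u1 * (v1 * - u2 + v2 * u1)); [ring | rewrite Im0 mulr0].
Qed.

Lemma Im_mulJ_comb (R : realType) (u v : R[i]) (a b a' b' : R) :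
  complex.Im ((a%:C * u + b%:C * v) * (a'%:C * u + b'%:C * v)^*) =
  (a' * b - a * b') * complex.Im (v * u^*).
Proof. by case: u v => [u1 u2] [v1 v2] /=; ring. Qed.

Theorem corollary1 (R : realType) (L : set 'cV[R[i]]_2) (d : int)
  (hL : is_lattice L)
  (d_nonsquare : forall n : int, d <> n ^+ 2)
  (d_gt0 : 0 < d)
  (hd : admits_sqrt_multiplication L d) :
  is_algebraic_torus L.
Proof.
have [D LD DD] := hd.
have [x [y [xy_free [N N0 xy_gen]]]] :=
  lattice_generators _ _ _ _ hL d_nonsquare LD DD.
pose s : R := Num.sqrt d%:~R.
have s0 : 0 < s by rewrite sqrtr_gt0 ltr0z.
have ss : s ^+ 2 = d%:~R by rewrite sqr_sqrtr // ler0z ltW.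
have DDs : D *m D = (s%:C ^+ 2)%:M.
  by rewrite DD -rmorphXn ss; congr _%:M; rewrite rmorph_int.
have nonscalar c : D + c%:C%:M != 0.
  apply/eqP => Dc.
  have [//|_ /eqP] := xy_free c 1 0 0; rewrite ?oner_eq0 //.
  rewrite !scale0r !addr0 -mul_scalar_mx addrC scale1r -mulmxDl Dc.
  exact: mul0mx.
have [f f0 fD] := left_eigenvector _ _ _ _ DDs (nonscalar s).
have [g g0 gD] : exists2 g : 'rV_2, g != 0 & g *m D = - s%:C *: g.
  apply: left_eigenvector; first by rewrite sqrrN.
  by rewrite -rmorphN; exact: nonscalar.
have fg_sep : forall z : 'cV_2, f *m z = 0 -> g *m z = 0 -> z = 0.
  apply: eigenvectors_separate f0 g0 fD gD.
  by rewrite -rmorphMn /= eq_complex /= mulrn_eq0 /= gt_eqF.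
pose F (h : 'rV[R[i]]_2) (z : 'cV[R[i]]_2) : R[i] := (h *m z) 0 0.
pose area h := complex.Im (F h y * (F h x)^*).
(* If the area vanishes, h kills a nonzero real combination z of x and y. Then
   both h and k kill (D + c) z, so that (D + c) z = 0 is a real relation between
   x, D x, y and D y. *)
have area_neq0 h k c : h *m D = c%:C *: h -> k *m D = - c%:C *: k ->
    (forall z : 'cV_2, h *m z = 0 -> k *m z = 0 -> z = 0) -> area h != 0.
  move=> hD kD sep; apply/eqP => /Im_mulJ_real_dependent[p [r [pr0 pr]]].
  pose z := p%:C *: x + r%:C *: y.
  have hz : h *m z = 0.
    apply/matrixP => k1 k2; rewrite !ord1 mulmxDr -!scalemxAr !mxE.
    by move: pr; rewrite /F !mxE.
  have : D *m z + c%:C *: z = 0.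
    apply: sep; rewrite mulmxDr -scalemxAr mulmxA ?hD ?kD -scalemxAl.
      by rewrite hz !scaler0 addr0.
    by rewrite scaleNr addNr.
  have -> : D *m z + c%:C *: z = (c * p)%:C *: x + p%:C *: (D *m x) +
      ((c * r)%:C *: y + r%:C *: (D *m y)).
    rewrite mulmxDr -!scalemxAr scalerDr !scalerA -!rmorphM addrC addrACA.
    by [].
  case/xy_free => _ p0 _ r0.
  by move: pr0; rewrite p0 r0 eqxx.
have areaf0 : area f != 0 by exact: area_neq0 fD gD fg_sep.
have areag0 : area g != 0.
  have gDs : g *m D = (- s)%:C *: g by rewrite rmorphN.
  have fDs : f *m D = - (- s)%:C *: f by rewrite rmorphN opprK.
  by apply: (area_neq0 _ _ _ _ gDs fDs) => z gz fz; exact: fg_sep.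
(* The scaling that turns the conjugate expressions below into a trace. *)
pose tau := if Num.sg (area f) == Num.sg (area g) then 1 else s.
have tau0 : 0 < tau by rewrite /tau; case: ifP.
pose coef h := N%:~R ^+ 2 * tau / `|area h|.
have coef0 h : area h != 0 -> 0 < coef h.
  move=> h0; rewrite divr_gt0 ?normr_gt0 // mulr_gt0 //.
  by rewrite exprn_even_gt0 //= intr_eq0.
have [H HE] := hermitian_pair R f g _ _ (coef0 f areaf0) (coef0 g areag0) fg_sep.
exists H => z z' /xy_gen[p [q [r [t zE]]]] /xy_gen[p' [q' [r' [t' z'E]]]].
have Fgen h (c : R) (z0 : 'cV_2) (p0 q0 r0 t0 : int) : h *m D = c%:C *: h ->
    N%:~R *: z0 = p0%:~R *: x + q0%:~R *: (D *m x) +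
      (r0%:~R *: y + t0%:~R *: (D *m y)) ->
    (N%:~R : R)%:C * F h z0 = (p0%:~R + q0%:~R * c)%:C * F h x +
      (r0%:~R + t0%:~R * c)%:C * F h y.
  move=> hD z0E.
  have := congr1 (F h) z0E.
  rewrite /F !mulmxDr -!scalemxAr !mulmxA hD -!scalemxAl.
  rewrite !mxE !rmorphD !rmorphM !rmorph_int => ->.
  move: (\sum_j _) (\sum_j _) => X Y; ring.
have term h c : area h != 0 -> h *m D = c%:C *: h ->
   complex.Im ((coef h)%:C * (F h z * (F h z')^*)) =
   tau * Num.sg (area h) * ((p'%:~R + q'%:~R * c) * (r%:~R + t%:~R * c) -
      (p%:~R + q%:~R * c) * (r'%:~R + t'%:~R * c)).
  move=> h0 hD.
  have -> : complex.Im ((coef h)%:C * (F h z * (F h z')^*)) =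
      tau / `|area h| * complex.Im
        (((N%:~R : R)%:C * F h z) * ((N%:~R : R)%:C * F h z')^*).
    rewrite /coef; case: (F h z) (F h z') => [z1 z2] [w1 w2] /=.
    by move: (_^-1) => w; ring.
  rewrite (Fgen h c z p q r t) // (Fgen h c z' p' q' r' t') //.
  rewrite Im_mulJ_comb -/(area h).
  have <- : area h / `|area h| = Num.sg (area h).
    by rewrite {1}(numEsg (area h)) mulfK // normr_eq0.
  by move: (_^-1) => w; ring.
have -> : H z z' = (coef f)%:C * (F f z * (F f z')^*) +
    (coef g)%:C * (F g z * (F g z')^*) by rewrite HE.
rewrite raddfD /=.
rewrite (term f s) // (term g (- s)) //; last by rewrite rmorphN.
rewrite /tau; have [<-|sg_neq] := eqVneq.
  rewrite [X in X \is a _](_ : _ = (sgz (area f) * 2 *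
    (p' * r + q' * t * d - p * r' - q * t' * d))%:~R) ?intr_int //.
  by rewrite !(intrM, intrB, intrD) -sgrEz -ss; ring.
have -> : Num.sg (area g) = - Num.sg (area f).
  by move: areaf0 areag0 sg_neq; do 2!case: sgrP => //; rewrite ?opprK ?eqxx.
rewrite [X in X \is a _](_ : _ = (sgz (area f) * 2 * d *
  (p' * t + q' * r - p * t' - q * r'))%:~R) ?intr_int //.
by rewrite !(intrM, intrB, intrD) -sgrEz -ss; ring.
Qed.
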